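(* Let $1\le p\le q\le\infty$. Let $(X,\mu)$ be a measure space, with $\mu$ semi-finite if $p=1$. Let $X=X_1\cup X_2\cup\cdots$ be a partition of $X$ and set $X^{(n)}:=X_1\cup\cdots\cup X_n$. Let $(b_n)_{n\ge1}$ and $(M_n)_{n\ge1}$ be sequences of weights. Let $m$ be an $L^{p'}(X)$ function and let $w_n$ be the $L^{p'}$-norm of $m$ on $X_n$. Then there exists $\rho>0$ such that the inequality $$\left(\sum_{n=1}^{\infty} b_n\left|\frac{1}{M_n}\int_{X^{(n)}}m(x)f(x)\,\mathrm{d}\mu(x)\right|^q\right)^{1/q}\le\rho\left(\sum_{n=1}^{\infty}b_n\int_{X_n}|f(x)|^p\,\mathrm{d}\mu(x)\right)^{1/p}$$ holds for every measurable function $f$ if and only if, with the same $\rho$, the discrete inequality $$\left(\sum_{n=1}^{\infty}b_n\left|\frac{1}{M_n}\sum_{k=1}^{n}w_ka_k\right|^q\right)^{1/q}\le\rho\left(\sum_{k=1}^{\infty}b_k|a_k|^p\right)^{1/p}$$ holds for every sequence $a=(a_k)_{k\ge1}$. That is, a given constant $\rho>0$ is admissible in the first inequality (for all $f$) if and only if that same constant $\rho$ is admissible in the second (for all $a$).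
   Context: A sequence of weights is any sequence of positive numbers. The partition is a countable partition into measurable sets. $p'$ is the Hölder conjugate of $p$, i.e. $\frac1p+\frac1{p'}=1$. Functions and sequences are complex-valued. The numbers $w_n$ are $$w_n=\left(\int_{X_n}|m(x)|^{p'}\,\mathrm{d}\mu(x)\right)^{1/p'}\ \text{if } p>1,\qquad w_n=\operatorname{ess\,sup}_{x\in X_n}|m(x)|\ \text{if } p=1.$$ The cases $p=\infty$ and $q=\infty$ are interpreted in the natural way. If $q=\infty$, the left-hand sides are read as $\sup_{b_n>0}\left|\frac1{M_n}\int_{X^{(n)}}mf\,\mathrm{d}\mu\right|$ and $\sup_{b_n>0}\left|\frac1{M_n}\sum_{k=1}^nw_ka_k\right|$ respectively. If $p=\infty$ (so $q=\infty$), the right-hand sides (apart from the factor $\rho$) are read as $\operatorname{ess\,sup}_{\cup_{b_n>0}X_n}|f(x)|$ and $\sup_{b_n>0}|a_n|$ respectively. *)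

(* Defs.v *)
From HB Require Import structures.
From mathcomp Require Import all_boot all_order all_algebra.
From mathcomp Require Import all_classical all_reals all_analysis.
From mathcomp Require Import complex.

Set Implicit Arguments.
Unset Strict Implicit.
Unset Printing Implicit Defensive.

Import Order.TTheory GRing.Theory Num.Theory.
Import numFieldNormedType.Exports.

Local Open Scope classical_set_scope.
Local Open Scope ring_scope.
Local Open Scope complex_scope.

(* The modulus with values in R; on R[i] the notation `|z| takes values in R[i]. *)
Definition cabs (R : realType) (z : R[i]) : R := Normc.normc z.

Definition cmeasurable d (T : measurableType d) (R : realType)
    (f : T -> R[i]) : Prop :=
  measurable_fun [set: T] (fun x => complex.Re (f x)) /\
  measurable_fun [set: T] (fun x => complex.Im (f x)).

(* Like the real integral of the library, this is total, hence meaningful only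
   if f is integrable on D. *)
Definition cintegral d (T : measurableType d) (R : realType)
    (mu : {measure set T -> \bar R}) (D : set T) (f : T -> R[i]) : R[i] :=
  (\int[mu]_(x in D) complex.Re (f x)) +i* (\int[mu]_(x in D) complex.Im (f x)).

(* The L^r-norm of f on D, as the norm on the whole space of the extension of f
   by zero outside D. *)
Definition cLnorm d (T : measurableType d) (R : realType)
    (mu : {measure set T -> \bar R}) (r : \bar R) (D : set T)
    (f : T -> R[i]) : \bar R :=
  ('N[mu]_r[(fun x => (cabs (f x))%:E) \_ D])%E.

Definition in_cL d (T : measurableType d) (R : realType)
    (mu : {measure set T -> \bar R}) (r : \bar R) (f : T -> R[i]) : Prop :=
  cmeasurable f /\ (cLnorm mu r [set: T] f < +oo)%E.

Definition semifinite d (T : measurableType d) (R : realType)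
    (mu : {measure set T -> \bar R}) : Prop :=
  forall A : set T, measurable A -> mu A = +oo%E ->
    exists B : set T, [/\ measurable B, B `<=` A & (0 < mu B < +oo)%E].

(* The parts are indexed by nat and are allowed to be empty, so that finite
   partitions are covered. *)
Definition countable_mpartition d (T : measurableType d)
    (X : nat -> set T) : Prop :=
  [/\ forall n, measurable (X n), trivIset [set: nat] X &
      \bigcup_n X n = [set: T]].

(* X^(n); since indices start at 0, the first n+1 parts. *)
Definition initial_part (T : Type) (X : nat -> set T) (n : nat) : set T :=
  \bigcup_(k in [set k | (k <= n)%N]) X k.

(* The value at r = -oo in the next two definitions is irrelevant: exponents
   are always at least 1. *)
Definition wseq_norm (R : realType) (b : nat -> R) (r : \bar R)
    (u : nat -> R[i]) : \bar R :=
  match r with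
  | r%:E => (\sum_(0 <= n <oo) ((b n)%:E * (cabs (u n) `^ r)%:E)) `^ r^-1
  | +oo => ereal_sup [set (cabs (u n))%:E | n in [set n | (0 < b n)%R]]
  | -oo => 0
  end%E.

Definition wfun_norm d (T : measurableType d) (R : realType)
    (mu : {measure set T -> \bar R}) (X : nat -> set T) (b : nat -> R)
    (r : \bar R) (f : T -> R[i]) : \bar R :=
  match r with
  | r%:E => (\sum_(0 <= n <oo)
      ((b n)%:E * \int[mu]_(x in X n) (cabs (f x) `^ r)%:E)) `^ r^-1
  | +oo => cLnorm mu +oo (\bigcup_(n in [set n | (0 < b n)%R]) X n) f
  | -oo => 0
  end%E.

(* Main.v *)
Require Import Defs.
From HB Require Import structures.
From mathcomp Require Import all_boot all_order all_algebra.
From mathcomp Require Import all_classical all_reals all_analysis.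
From mathcomp Require Import complex.
From mathcomp Require Import ring measurable_realfun ess_sup_inf.

Set Implicit Arguments.
Unset Strict Implicit.
Unset Printing Implicit Defensive.

Import Order.TTheory GRing.Theory Num.Theory.
Import numFieldNormedType.Exports.

Local Open Scope classical_set_scope.
Local Open Scope ring_scope.
Local Open Scope complex_scope.

(** The two inequalities are compared part by part, with [a k] in the role of
    the norm of [f] on [X k].

    From sequences to functions: let [a k] be the L^p-norm of [f] on [X k].
    Hoelder's inequality on [X k] bounds the integral of [m f] by [w k * a k]
    ([cabs_cintegralM_le]), so the left-hand side for [f] is at most the one
    for [a], while the right-hand side for [a] is at most the one for [f]
    ([wfun_norm_ge]). If the right-hand side for [f] is infinite there is
    nothing to prove; otherwise every [a k] is finite, [m f] is integrable on
    every part, and its integral over the union of the first parts is the sum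
    of the integrals.

    From functions to sequences: Hoelder's inequality is sharp. For each [r] in
    ]0, 1[ there is [g k] whose product with [m] has integral exactly [w k] over
    [X k] and whose L^p-norm on [X k] is at most [r^-1] ([near_extremal]). The
    function [f] equal to [r * a k * g k] on [X k] has norm at most [|a k|]
    there, so its right-hand side is at most the one for [a]
    ([wfun_norm_le]), and its left-hand side is [r] times the one for [a].
    As the bound on [g k] is the same for all [k], letting [r] tend to 1 gives
    the discrete inequality with the same constant.

    The extremal functions depend on [p], with [p'] the conjugate exponent. For
    1 < p < oo, [m g] is |m|^p' divided by [w ^ (p' - 1)]; for p = oo it is
    |m|. For p = 1 it is constant on a set of finite positive measure where
    |m| > r w and zero elsewhere; semi-finiteness provides this set. *)

(** * The modulus *)

Section modulus.
Context (R : realType).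
Implicit Types (z u : R[i]) (r : R).

Lemma cabs_ge0 z : 0 <= cabs z.
Proof. by case: z => x y; rewrite /cabs /= sqrtr_ge0. Qed.

Lemma cabsM z u : cabs (z * u) = cabs z * cabs u.
Proof. exact: Normc.normcM. Qed.

Lemma cabs_real r : cabs r%:C = `|r|.
Proof. by rewrite /cabs /= expr0n addr0 sqrtr_sqr. Qed.

Lemma cabs_sum n (F : 'I_n -> R[i]) :
  cabs (\sum_(i < n) F i) <= \sum_(i < n) cabs (F i).
Proof.
elim/big_ind2 : _ => [|z x u y zx uy|//]; first by rewrite /cabs Normc.normc0.
exact: le_trans (le_normcD _ _) (lerD zx uy).
Qed.

Lemma sqr_cabs z : cabs z ^+ 2 = complex.Re z ^+ 2 + complex.Im z ^+ 2.
Proof. by case: z => x y; rewrite /cabs /= sqr_sqrtr// addr_ge0// sqr_ge0. Qed.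

Lemma normr_Re_le z : `|complex.Re z| <= cabs z.
Proof.
rewrite -ler_sqr ?nnegrE ?cabs_ge0// real_normK ?num_real// sqr_cabs.
by rewrite lerDl sqr_ge0.
Qed.

Lemma normr_Im_le z : `|complex.Im z| <= cabs z.
Proof.
rewrite -ler_sqr ?nnegrE ?cabs_ge0// real_normK ?num_real// sqr_cabs.
by rewrite lerDr sqr_ge0.
Qed.

Lemma ReM z u : complex.Re (z * u) =
  complex.Re z * complex.Re u - complex.Im z * complex.Im u.
Proof. by case: z u => [? ?] [? ?]. Qed.

Lemma ImM z u : complex.Im (z * u) =
  complex.Re z * complex.Im u + complex.Im z * complex.Re u.
Proof. by case: z u => [? ?] [? ?]. Qed.

(** Cauchy-Schwarz in the plane: the left-hand side is the real part of the
    product of the conjugate of [z] with [u]. *)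
Lemma inner_le_cabs z u :
  complex.Re z * complex.Re u + complex.Im z * complex.Im u <= cabs z * cabs u.
Proof.
rewrite -[cabs z](_ : cabs (complex.Re z -i* complex.Im z) = _).
  rewrite -cabsM; apply: le_trans (normr_Re_le _).
  by case: u z => [? ?] [? ?] /=; rewrite mulNr opprK ler_norm.
by case: z => x y; rewrite /cabs /= sqrrN.
Qed.

End modulus.

(** * Measurability and integrals of complex functions *)

Section complex_measurable.
Context d (T : measurableType d) (R : realType).
Implicit Types (f g : T -> R[i]) (D : set T).

Lemma cmeasurableM f g : cmeasurable f -> cmeasurable g ->
  cmeasurable (fun x => f x * g x).
Proof.
move=> [f1 f2] [g1 g2]; split.
  under eq_fun do rewrite ReM.
  by apply: measurable_funB; exact: measurable_funM.
under eq_fun do rewrite ImM.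
by apply: measurable_funD; exact: measurable_funM.
Qed.

Lemma cmeasurable_cst (z : R[i]) : cmeasurable (fun _ : T => z).
Proof. by split; exact: measurable_cst. Qed.

Lemma cmeasurable_real (h : T -> R) : measurable_fun [set: T] h ->
  cmeasurable (fun x => (h x)%:C).
Proof. by move=> mh; split => //=; exact: measurable_cst. Qed.

Lemma measurable_cabs f : cmeasurable f ->
  measurable_fun [set: T] (fun x => cabs (f x)).
Proof.
move=> [f1 f2].
have -> : (fun x => cabs (f x)) = (fun x => 
   (complex.Re (f x) ^+ 2 + complex.Im (f x) ^+ 2) `^ 2^-1).
  apply/funext => x; rewrite -sqr_cabs -powR_mulrn ?cabs_ge0// -powRrM.
  by rewrite mulfV ?pnatr_eq0// powRr1// cabs_ge0.
apply: (@measurableT_comp _ _ _ _ _ _ (@powR R ^~ _)) => //.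
by apply: measurable_funD; exact: measurable_funX.
Qed.

Lemma cmeasurableV f : cmeasurable f -> cmeasurable (fun x => (f x)^-1).
Proof.
move=> mf; have [f1 f2] := mf.
have mn : measurable_fun [set: T] (fun x => (cabs (f x) ^+ 2) `^ (-1)).
  apply: (@measurableT_comp _ _ _ _ _ _ (@powR R ^~ _)) => //.
  by apply: measurable_funX; exact: measurable_cabs.
have mnE x : (cabs (f x) ^+ 2) `^ (-1) =
  (complex.Re (f x) ^+ 2 + complex.Im (f x) ^+ 2)^-1.
  by rewrite powR_inv1 ?exprn_ge0 ?cabs_ge0// sqr_cabs.
split.
  have -> : (fun x => complex.Re (f x)^-1) =
      (fun x => complex.Re (f x) * (cabs (f x) ^+ 2) `^ (-1)).
    by apply/funext => x; rewrite mnE; case: (f x).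
  exact: measurable_funM.
have -> : (fun x => complex.Im (f x)^-1) =
    (fun x => - (complex.Im (f x) * (cabs (f x) ^+ 2) `^ (-1))).
  by apply/funext => x; rewrite mnE; case: (f x).
by apply: measurable_funN; exact: measurable_funM.
Qed.

(** As there are countably many parts, measurability can be checked on each of
    them, where the glued function coincides with a measurable one. *)
Lemma cmeasurable_glue (X : nat -> set T) (F : nat -> T -> R[i]) :
  countable_mpartition X -> (forall n, cmeasurable (F n)) ->
  exists2 f : T -> R[i], cmeasurable f & forall n x, X n x -> f x = F n x.
Proof.
move=> [mX tX XT] mF.
have part x : exists n, X n x.
  by have : [set: T] x by []; rewrite -XT => -[n _]; exists n.
pose f x := F (projT1 (cid (part x))) x.
have fE n x : X n x -> f x = F n x.
  rewrite /f => Xnx; case: cid => k /= Xkx; congr F.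
  by apply: tX => //; exists x.
exists f => //; split; rewrite -XT; apply/measurable_fun_bigcup => // n.
  apply: (@eq_measurable_fun _ _ _ _ _ (fun x => complex.Re (F n x))).
    by move=> x; rewrite inE => /fE ->.
  exact: measurable_funTS (mF n).1.
apply: (@eq_measurable_fun _ _ _ _ _ (fun x => complex.Im (F n x))).
  by move=> x; rewrite inE => /fE ->.
exact: measurable_funTS (mF n).2.
Qed.

End complex_measurable.

Section complex_integral.
Context d (T : measurableType d) (R : realType).
Context (mu : {measure set T -> \bar R}).
Implicit Types (f g h : T -> R[i]) (D : set T).

Lemma integrable_cabs D h : measurable D -> cmeasurable h ->
    (\int[mu]_(x in D) (cabs (h x))%:E < +oo)%E ->
  mu.-integrable D (EFin \o (fun x => cabs (h x))).
Proof.
move=> mD mh hoo; apply/integrableP; split.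
  by apply/measurable_EFinP/measurable_funTS/measurable_cabs.
by under eq_integral do rewrite /= ger0_norm ?cabs_ge0//.
Qed.

Lemma integrable_Re D h : measurable D -> cmeasurable h ->
    (\int[mu]_(x in D) (cabs (h x))%:E < +oo)%E ->
  mu.-integrable D (EFin \o (fun x => complex.Re (h x))).
Proof.
move=> mD mh hoo; apply: le_integrable (integrable_cabs mD mh hoo) => //.
  by apply/measurable_EFinP/measurable_funTS; case: mh.
by move=> x _; rewrite /= lee_fin [leRHS]ger0_norm ?cabs_ge0// normr_Re_le.
Qed.

Lemma integrable_Im D h : measurable D -> cmeasurable h ->
    (\int[mu]_(x in D) (cabs (h x))%:E < +oo)%E ->
  mu.-integrable D (EFin \o (fun x => complex.Im (h x))).
Proof.
move=> mD mh hoo; apply: le_integrable (integrable_cabs mD mh hoo) => //.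
  by apply/measurable_EFinP/measurable_funTS; case: mh.
by move=> x _; rewrite /= lee_fin [leRHS]ger0_norm ?cabs_ge0// normr_Im_le.
Qed.

(** With [z] the integral, [cabs z ^+ 2] is the integral of the real inner
    product of [z] with [h], which is at most [cabs z * cabs h]. *)
Lemma cabs_cintegral_le D h : measurable D -> cmeasurable h ->
    (\int[mu]_(x in D) (cabs (h x))%:E < +oo)%E ->
  ((cabs (cintegral mu D h))%:E <= \int[mu]_(x in D) (cabs (h x))%:E)%E.
Proof.
move=> mD mh hoo; set z := cintegral mu D h.
have iA := integrable_cabs mD mh hoo.
have iR := integrable_Re mD mh hoo; have iI := integrable_Im mD mh hoo.
have iRz := integrableZl mD (complex.Re z) iR.
have iIz := integrableZl mD (complex.Im z) iI.
have iAz := integrableZl mD (cabs z) iA.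
have zz : cabs z ^+ 2 <= cabs z * \int[mu]_(x in D) cabs (h x).
  have zRe : complex.Re z = \int[mu]_(x in D) complex.Re (h x) by [].
  have zIm : complex.Im z = \int[mu]_(x in D) complex.Im (h x) by [].
  rewrite sqr_cabs !expr2 -RintegralZl// {2}zRe {2}zIm -!RintegralZl//.
  rewrite -RintegralD//; apply: le_Rintegral => //.
    exact: (integrableD mD iRz iIz).
  by move=> x _; exact: inner_le_cabs.
have AE : (\int[mu]_(x in D) (cabs (h x))%:E =
           (\int[mu]_(x in D) cabs (h x))%:E)%E.
  by rewrite /Rintegral fineK// (integrable_fin_num mD iA).
rewrite AE lee_fin.
have [->|z0] := eqVneq (cabs z) 0.
  by apply: Rintegral_ge0 => x _; exact: cabs_ge0.
by move: zz; rewrite expr2 ler_pM2l// lt0r z0 cabs_ge0.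
Qed.

Lemma eq_cintegral D f h : (forall x, D x -> f x = h x) ->
  cintegral mu D f = cintegral mu D h.
Proof.
by move=> fh; rewrite /cintegral; congr (_ +i* _); apply: eq_Rintegral => x;
  rewrite inE => /fh ->.
Qed.

Lemma cintegralZ D z h : measurable D -> cmeasurable h ->
    (\int[mu]_(x in D) (cabs (h x))%:E < +oo)%E ->
  cintegral mu D (fun x => z * h x) = z * cintegral mu D h.
Proof.
move=> mD mh hoo.
have iR := integrable_Re mD mh hoo; have iI := integrable_Im mD mh hoo.
have iZ (r : R) := integrableZl mD r iR; have iZ' (r : R) := integrableZl mD r iI.
apply/eqP; rewrite eq_complex ReM ImM /cintegral /=; apply/andP; split; apply/eqP.
  under eq_Rintegral do rewrite ReM.
  rewrite RintegralB ?RintegralZl//; [exact: iZ|exact: iZ'].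
under eq_Rintegral do rewrite ImM.
rewrite RintegralD ?RintegralZl//; [exact: iZ'|exact: iZ].
Qed.

Lemma cintegral_initial_part (X : nat -> set T) n h :
  countable_mpartition X -> cmeasurable h ->
  (forall k, (\int[mu]_(x in X k) (cabs (h x))%:E < +oo)%E) ->
  cintegral mu (initial_part X n) h = \sum_(k < n.+1) cintegral mu (X k) h.
Proof.
move=> [mX tX XT] mh hoo.
have key (u : T -> R) : measurable_fun [set: T] u ->
    (forall k, mu.-integrable (X k) (EFin \o u)) ->
    \int[mu]_(x in initial_part X n) u x =
    \sum_(k < n.+1) \int[mu]_(x in X k) u x.
  move=> mu_u iu; rewrite /initial_part.
  have -> : \bigcup_(k in [set k | (k <= n)%N]) X k =
      \big[setU/set0]_(k <- iota 0 n.+1) X k.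
    by rewrite -bigcup_seq; apply: eq_bigcupl; split => k;
       rewrite /mkset mem_iota.
  rewrite /Rintegral integral_bigsetU_EFin ?iota_uniq//; last 2 first.
  - exact: sub_trivIset tX.
  - by apply/measurable_EFinP; exact: measurable_funTS.
  rewrite -(subn0 n.+1) -/(index_iota 0 n.+1) big_mkord subn0.
  by rewrite -sum_fine// => k _; exact: integrable_fin_num.
rewrite /cintegral (key _ mh.1) ?(key _ mh.2); last 2 first.
- by move=> k; exact: integrable_Im.
- by move=> k; exact: integrable_Re.
elim/big_ind3 : _ => //= _ x1 y1 _ x2 y2 <- <-; reflexivity.
Qed.

End complex_integral.

(** * Norms of complex functions on a part *)

Section norm_on_a_part.
Context d (T : measurableType d) (R : realType).
Context (mu : {measure set T -> \bar R}).
Implicit Types (f g m : T -> R[i]) (D : set T).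

Lemma cLnorm_ge0 p D f : (0 <= cLnorm mu p D f)%E.
Proof. exact: Lnorm_ge0. Qed.

Lemma poweR_cLnorm (r : R) D f : r != 0 ->
  (cLnorm mu r%:E D f `^ r = \int[mu]_(x in D) (cabs (f x) `^ r)%:E)%E.
Proof.
move=> r0; rewrite /cLnorm poweR_Lnorm// [RHS]integral_mkcond.
apply: eq_integral => x _; rewrite /patch; case: ifPn => _.
  by rewrite /= ger0_norm ?cabs_ge0.
by rewrite abse0 poweR0r.
Qed.

Lemma cLnorm1 D f :
  (cLnorm mu 1 D f = \int[mu]_(x in D) (cabs (f x))%:E)%E.
Proof.
rewrite -[LHS]poweRe1 ?cLnorm_ge0// poweR_cLnorm ?oner_neq0//.
by apply: eq_integral => x _; rewrite powRr1 ?cabs_ge0.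
Qed.

Lemma cLnorm0 p D f : (1 <= p)%E -> (forall x, f x = 0) -> cLnorm mu p D f = 0%E.
Proof.
move=> p1 f0; rewrite /cLnorm -[RHS](@Lnorm0 _ _ _ mu p).
  apply: eq_Lnorm => x; rewrite /patch; case: ifP => // _.
  by rewrite f0 /cabs Normc.normc0.
by rewrite gt_eqF// (lt_le_trans _ p1).
Qed.

(** The equivalence survives when the whole space is null: the norm is then
    zero by convention, and every bound holds almost everywhere. *)
Lemma cLnormy_leP D f (y : R) : 0 <= y ->
  (cLnorm mu +oo D f <= y%:E)%E <-> (\forall x \ae mu, D x -> cabs (f x) <= y).
Proof.
move=> y0; rewrite /cLnorm unlock; have [mu0|mu0] := ltP; last first.
  split=> // _; exists setT; split => //.
  by apply/eqP; rewrite eq_le mu0 measure_ge0.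
split=> [/ess_supP|H].
  apply: filterS => x /=; rewrite /patch => + Dx.
  by rewrite mem_set//= ger0_norm ?cabs_ge0.
apply/ess_supP; apply: filterS H => x /= H; rewrite /patch.
case: ifPn => [/set_mem /H|_]; last by rewrite abse0 lee_fin.
by rewrite /= ger0_norm ?cabs_ge0 ?lee_fin.
Qed.

Lemma eq_cLnorm p D f g : (forall x, D x -> f x = g x) ->
  cLnorm mu p D f = cLnorm mu p D g.
Proof.
move=> fg; apply: eq_Lnorm => x; rewrite /patch.
by case: ifPn => // /set_mem /fg ->.
Qed.

Lemma cLnormZ_le p D f (z : R[i]) (c : R) : (1 <= p)%E -> measurable D ->
    cmeasurable f -> 0 <= c -> (cLnorm mu p D f <= c%:E)%E ->
  (cLnorm mu p D (fun x => z * f x)%R <= (cabs z * c)%:E)%E.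
Proof.
case: p => [p||//] p1 mD mf c0 fc; last first.
  apply/cLnormy_leP; first by rewrite mulr_ge0 ?cabs_ge0.
  move/(cLnormy_leP _ _ c0) : fc; apply: filterS => x fc Dx.
  by rewrite cabsM ler_wpM2l ?cabs_ge0// fc.
have p0 : 0 < p by rewrite (lt_le_trans ltr01).
suff -> : (cLnorm mu p%:E D (fun x => z * f x)%R =
    (cabs z)%:E * cLnorm mu p%:E D f)%E.
  by rewrite EFinM lee_wpmul2l// lee_fin cabs_ge0.
rewrite -[LHS]poweRe1 ?cLnorm_ge0// -[RHS]poweRe1; last first.
  by rewrite mule_ge0 ?cLnorm_ge0// lee_fin cabs_ge0.
rewrite -(mulfV (lt0r_neq0 p0)) !poweRrM; congr (_ `^ _)%E.
rewrite poweRM ?cLnorm_ge0 ?lee_fin ?cabs_ge0// !poweR_cLnorm ?gt_eqF//.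
under eq_integral do rewrite cabsM powRM ?cabs_ge0// EFinM.
rewrite ge0_integralZl_EFin ?powR_ge0//.
  by move=> x _; rewrite lee_fin powR_ge0.
apply/measurable_EFinP/measurable_funTS.
apply: (@measurableT_comp _ _ _ _ _ _ (@powR R ^~ _)) => //.
exact: measurable_cabs.
Qed.

(** Hoelder's inequality for the exponents infinity and 1. Both endpoint cases
    of [hoelder_cLnorm] follow from it, the roles of [m] and [f] being
    exchanged. *)
Lemma integral_cabsM_le D f g (a c : R) : measurable D ->
    cmeasurable f -> cmeasurable g -> 0 <= a ->
    (cLnorm mu +oo D f <= a%:E)%E -> (cLnorm mu 1 D g <= c%:E)%E ->
  (\int[mu]_(x in D) (cabs (f x * g x))%:E <= (a * c)%:E)%E.
Proof.
move=> mD mf mg a0 /(cLnormy_leP _ _ a0) fa gc.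
have mg' : measurable_fun D (fun x => (cabs (g x))%:E).
  by apply/measurable_EFinP/measurable_funTS/measurable_cabs.
rewrite EFinM; apply: le_trans (lee_wpmul2l _ gc); last by rewrite lee_fin.
rewrite cLnorm1 -ge0_integralZl//; last by move=> x _; rewrite lee_fin cabs_ge0.
apply: ae_ge0_le_integral => //.
- by move=> x _; rewrite lee_fin cabs_ge0.
- apply/measurable_EFinP/measurable_funTS.
  exact: measurable_cabs (cmeasurableM mf mg).
- by move=> x _; rewrite -EFinM lee_fin mulr_ge0 ?cabs_ge0.
- exact: emeasurable_funM.
- apply: filterS fa => x fa Dx; rewrite -EFinM lee_fin cabsM.
  by rewrite ler_wpM2r ?cabs_ge0// fa.
Qed.

Lemma hoelder_conjugate_real (p : R) : 1 < p ->
  hoelder_conjugate p%:E = (p / (p - 1))%:E.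
Proof.
move=> p1; rewrite /hoelder_conjugate /= eqe gt_eqF ?(lt_trans ltr01)//.
by rewrite -EFinD inver subr_eq0 gt_eqF.
Qed.

Lemma hoelder_cLnorm (p : \bar R) D m f (w a : R) : (1 <= p)%E ->
    measurable D -> cmeasurable m -> cmeasurable f ->
    cLnorm mu (hoelder_conjugate p) D m = w%:E -> cLnorm mu p D f = a%:E ->
  (\int[mu]_(x in D) (cabs (m x * f x))%:E <= (w * a)%:E)%E.
Proof.
move=> p1 mD mm mf wE aE.
have w0 : 0 <= w by rewrite -lee_fin -wE cLnorm_ge0.
have a0 : 0 <= a by rewrite -lee_fin -aE cLnorm_ge0.
case: p p1 wE aE => [p|_|//].
- rewrite lee_fin le_eqVlt => /predU1P[<-|p1] wE aE.
    rewrite hoelder_conjugate1 in wE.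
    by apply: integral_cabsM_le => //; rewrite ?wE ?aE.
  rewrite (hoelder_conjugate_real p1) in wE.
  have p0 : 0 < p by exact: lt_trans p1.
  have s0 : 0 < p / (p - 1) by rewrite divr_gt0// subr_gt0.
  pose M := (fun x => cabs (m x)) \_ D; pose F := (fun x => cabs (f x)) \_ D.
  have mM : measurable_fun [set: T] M.
    apply: (measurable_restrictT _ mD).1.
    exact: measurable_funTS (measurable_cabs _).
  have mF : measurable_fun [set: T] F.
    apply: (measurable_restrictT _ mD).1.
    exact: measurable_funTS (measurable_cabs _).
  have := @hoelder _ _ _ mu M F (p / (p - 1)) p mM mF s0 p0.
  rewrite invf_div mulrBl mulfV ?gt_eqF// mul1r subrK => /(_ erefl).
  rewrite -!restrict_EFin -!/(cLnorm _ _ _ _) wE aE -EFinM; apply: le_trans.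
  rewrite Lnorm1 integral_mkcond le_eqVlt; apply/orP; left; apply/eqP.
  apply: eq_integral => x _; rewrite /M /F /patch /=; case: ifPn => _.
    by rewrite cabsM ger0_norm// mulr_ge0 ?cabs_ge0.
  by rewrite mulr0 normr0.
move=> wE aE; rewrite mulrC; under eq_integral do rewrite mulrC.
by apply: integral_cabsM_le; rewrite ?aE -?wE.
Qed.

Lemma cabs_cintegralM_le (p : \bar R) D m f (w a : R) : (1 <= p)%E ->
    measurable D -> cmeasurable m -> cmeasurable f ->
    cLnorm mu (hoelder_conjugate p) D m = w%:E -> cLnorm mu p D f = a%:E ->
  cabs (cintegral mu D (fun x => m x * f x)) <= w * a.
Proof.
move=> p1 mD mm mf wE aE; have le_wa := hoelder_cLnorm p1 mD mm mf wE aE.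
rewrite -lee_fin; apply: (le_trans _ le_wa); apply: cabs_cintegral_le => //.
  exact: cmeasurableM.
exact: le_lt_trans le_wa (ltry _).
Qed.

End norm_on_a_part.

(** * Extremal functions for Hoelder's inequality *)

Section extremal.
Context d (T : measurableType d) (R : realType).
Context (mu : {measure set T -> \bar R}).
Implicit Types (f g m : T -> R[i]) (D : set T).

Lemma semifinite_finite_subset (A : set T) : semifinite mu ->
    measurable A -> (0 < mu A)%E ->
  exists B, [/\ measurable B, B `<=` A & (0 < mu B < +oo)%E].
Proof.
move=> smu mA A0; have [Aoo|Afin] := eqVneq (mu A) +oo%E; first exact: smu.
by exists A; split => //; rewrite A0 ltey.
Qed.

(** Dividing [phi] by [m] itself rather than by its modulus aligns the phases, so
    that [m g] is real and nonnegative and no cancellation occurs in its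
    integral. *)
Lemma aligned_factor m (phi : T -> R) : cmeasurable m ->
    measurable_fun [set: T] phi -> (forall x, 0 <= phi x) ->
    (forall x, m x = 0 -> phi x = 0) ->
  exists g, [/\ cmeasurable g, forall x, m x * g x = (phi x)%:C &
    forall x, cabs (g x) = phi x / cabs (m x)].
Proof.
move=> mm mphi phi0 mphi0; exists (fun x => (phi x)%:C * (m x)^-1); split.
- by apply: cmeasurableM; [exact: cmeasurable_real|exact: cmeasurableV].
- move=> x; have [m0|m0] := eqVneq (m x) 0; last by rewrite mulrC divfK.
  by rewrite m0 mul0r mphi0.
- by move=> x; rewrite cabsM cabs_real ger0_norm// /cabs Normc.normcV.
Qed.

Lemma cintegral_real D f (phi : T -> R) (w : R) :
    (forall x, f x = (phi x)%:C) -> (\int[mu]_(x in D) (phi x)%:E = w%:E)%E ->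
  cintegral mu D f = w%:C.
Proof.
move=> fE phiw; rewrite /cintegral; congr (_ +i* _).
  by rewrite /Rintegral; under eq_integral do rewrite fE; rewrite phiw.
by under eq_Rintegral do rewrite fE; rewrite /Rintegral integral0.
Qed.

(** The equality case of Hoelder's inequality: |g|^p is proportional to |m|^s,
    where [s] is the conjugate exponent. The factor [w `^ (1 - s)] makes the
    integral of [m g] equal to [w], and then the norm of [g] is 1, because
    [(s - 1) * p = s]. *)
Lemma extremal_gt1 (p : R) D m (w : R) : 1 < p -> measurable D ->
    cmeasurable m -> 0 < w ->
    cLnorm mu (hoelder_conjugate p%:E) D m = w%:E ->
  exists g, [/\ cmeasurable g,
    cintegral mu D (fun x => m x * g x) = w%:C & (cLnorm mu p%:E D g <= 1)%E].
Proof.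
move=> p1 mD mm w0; rewrite (hoelder_conjugate_real p1) => wE.
set s := p / (p - 1) in wE.
have p0 : 0 < p by exact: lt_trans p1.
have s0 : 0 < s by rewrite divr_gt0// subr_gt0.
have sp : (s - 1) * p = s.
  by rewrite /s; field; rewrite subr_eq0 gt_eqF.
have ints : (\int[mu]_(x in D) (cabs (m x) `^ s)%:E = (w `^ s)%:E)%E.
  by rewrite -poweR_cLnorm ?gt_eqF// wE poweR_EFin.
have mpow : measurable_fun [set: T] (fun x => cabs (m x) `^ s).
  apply: (@measurableT_comp _ _ _ _ _ _ (@powR R ^~ _)) => //.
  exact: measurable_cabs.
have int1 (k : R) : 0 <= k ->
    (\int[mu]_(x in D) (k * cabs (m x) `^ s)%:E = (k * w `^ s)%:E)%E.
  move=> k0; under eq_integral do rewrite EFinM.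
  rewrite ge0_integralZl_EFin ?ints//.
    by move=> x _; rewrite lee_fin powR_ge0.
  by apply/measurable_EFinP/measurable_funTS.
have [|||g [mg mgE gE]] :=
    @aligned_factor m (fun x => w `^ (1 - s) * cabs (m x) `^ s) mm.
- exact: measurable_funM.
- by move=> x; rewrite mulr_ge0 ?powR_ge0.
- by move=> x ->; rewrite /cabs Normc.normc0 powR0 ?mulr0// gt_eqF.
have powg x : cabs (g x) `^ p = w `^ (- s) * cabs (m x) `^ s.
  rewrite gE; have [m0|m0] := eqVneq (cabs (m x)) 0.
    by rewrite m0 invr0 mulr0 !powR0 ?mulr0// gt_eqF.
  have mp : 0 < cabs (m x) by rewrite lt0r m0 cabs_ge0.
  rewrite -mulrA -[_^-1]powR_inv1 ?cabs_ge0// -powRD ?m0 ?implybT//.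
  rewrite powRM ?powR_ge0// -!powRrM sp.
  by rewrite -opprB mulNr sp.
exists g; split=> //.
  apply: (cintegral_real mgE); rewrite int1 ?powR_ge0//.
  rewrite -powRD; last by rewrite (gt_eqF w0) implybT.
  by rewrite subrK powRr1 ?ltW.
rewrite -[leLHS]poweRe1 ?cLnorm_ge0// -[X in (_ `^ X)%E](mulfV (lt0r_neq0 p0)) poweRrM.
rewrite poweR_cLnorm ?gt_eqF//.
under eq_integral do rewrite powg.
rewrite int1 ?powR_ge0// -powRD; last by rewrite (gt_eqF w0) implybT.
by rewrite addNr powRr0 poweR1r.
Qed.

(** The essential supremum [w] need not be attained, but |m| exceeds [r * w] on
    a set of positive measure. Concentrating [m g] uniformly on a part [B] of it
    of finite measure costs at most the factor [r^-1]. *)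
Lemma extremal_eq1 D m (w r : R) : semifinite mu -> measurable D ->
    cmeasurable m -> 0 < w -> 0 < r < 1 -> cLnorm mu +oo D m = w%:E ->
  exists g, [/\ cmeasurable g,
    cintegral mu D (fun x => m x * g x) = w%:C &
    (cLnorm mu 1 D g <= (r^-1)%:E)%E].
Proof.
move=> smu mD mm w0 /andP[r0 r1] wE.
have mcm := measurable_cabs mm.
have rw0 : 0 < r * w by rewrite mulr_gt0.
pose A := D `&` [set x | r * w < cabs (m x)].
have mA : measurable A.
  rewrite (_ : A = D `&` (fun x => r * w < cabs (m x)) @^-1` [set true])//.
  apply: measurable_fun_ltr => //; exact: measurable_funTS.
have A0 : (0 < mu A)%E.
  rewrite lt0e measure_ge0 andbT; apply/eqP => A0.
  have : (cLnorm mu +oo D m <= (r * w)%:E)%E.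
    apply/cLnormy_leP; first exact: ltW.
    exists A; split=> // x /= /not_implyP[Dx /negP]; rewrite -ltNge.
    by split.
  by rewrite wE lee_fin leNgt -{2}[w]mul1r ltr_pM2r// r1.
have [B [mB BA /andP[B0 Boo]]] := semifinite_finite_subset smu mA A0.
pose c := fine (mu B).
have cE : (mu B = c%:E)%E by rewrite fineK// ge0_fin_numE// ltW.
have c0 : 0 < c by rewrite -lte_fin -cE.
have BD : B `&` D = B by apply: setIidl => x /BA[].
have int1 (k : R) : 0 <= k ->
    (\int[mu]_(x in D) (k * \1_B x)%:E = (k * c)%:E)%E.
  move=> k0; under eq_integral do rewrite EFinM.
  rewrite ge0_integralZl_EFin//; last first.
    by apply/measurable_EFinP; exact: measurable_indic.
  by rewrite integral_indic// BD cE.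
have [|||g [mg mgE gE]] := @aligned_factor m (fun x => w / c * \1_B x) mm.
- by apply: measurable_funM => //; exact: measurable_indic.
- by move=> x; rewrite mulr_ge0// divr_ge0// ltW.
- move=> x m0; rewrite indicE; case: (boolP (x \in B)) => [|_].
    move=> /set_mem/BA[_ /=].
    by rewrite m0 /cabs Normc.normc0 ltNge (ltW rw0).
  by rewrite mulr0.
exists g; split=> //.
  apply: (cintegral_real mgE); rewrite int1 ?divr_ge0 ?ltW//.
  by rewrite divfK// gt_eqF.
rewrite cLnorm1; apply: (@le_trans _ _ (\int[mu]_(x in D) ((r * c)^-1 * \1_B x)%:E)%E).
  apply: ge0_le_integral => //.
  - by move=> x _; rewrite lee_fin cabs_ge0.
  - apply/measurable_EFinP/measurable_funTS; exact: measurable_cabs.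
  - apply/measurable_EFinP/measurable_funM => //; exact: measurable_indic.
  - move=> x _; rewrite lee_fin gE indicE.
    case: (boolP (x \in B)) => [|_]; last by rewrite !mulr0 mul0r.
    move=> /set_mem/BA[_ /= rwm]; rewrite !mulr1.
    rewrite ler_pdivrMr ?(lt_trans rw0)// invfM mulrAC.
    by rewrite ler_pM2r ?invr_gt0// ler_pdivlMl// ltW.
rewrite int1; last by rewrite invr_ge0 mulr_ge0 ?ltW.
by rewrite invfM -mulrA mulVf ?mulr1// gt_eqF.
Qed.

(** Here [g] is the conjugate phase of [m], of modulus 1 or, at the zeros of
    [m], 0. *)
Lemma extremal_eqy D m (w : R) : measurable D ->
    cmeasurable m -> cLnorm mu 1 D m = w%:E ->
  exists g, [/\ cmeasurable g,
    cintegral mu D (fun x => m x * g x) = w%:C & (cLnorm mu +oo D g <= 1)%E].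
Proof.
move=> mD mm wE.
have [|||g [mg mgE gE]] := @aligned_factor m (fun x => cabs (m x)) mm.
- exact: measurable_cabs.
- by move=> x; exact: cabs_ge0.
- by move=> x ->; rewrite /cabs Normc.normc0.
exists g; split=> //; first by apply: (cintegral_real mgE); rewrite -cLnorm1.
apply/cLnormy_leP => //; apply: nearW => x _; rewrite gE.
by have [->|m0] := eqVneq (cabs (m x)) 0; [rewrite mul0r|rewrite mulfV].
Qed.

(** Hoelder's inequality is sharp up to a factor [r] arbitrarily close to 1. The
    pairing with [m] is normalised exactly and the slack is put on the norm of
    [g], so that functions chosen on different parts can be glued with one and
    the same [r]. *)
Lemma near_extremal (p : \bar R) D m (w r : R) : (1 <= p)%E ->
    (p = 1%E -> semifinite mu) -> measurable D -> cmeasurable m ->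
    0 < r < 1 -> cLnorm mu (hoelder_conjugate p) D m = w%:E ->
  exists g, [/\ cmeasurable g,
    cintegral mu D (fun x => m x * g x) = w%:C &
    (cLnorm mu p D g <= (r^-1)%:E)%E].
Proof.
move=> p1 smu mD mm r01 wE; have /andP[r0 r1] := r01.
have r1V : (1 <= (r^-1)%:E)%E by rewrite lee_fin invf_ge1// ltW.
have : 0 <= w by rewrite -lee_fin -wE cLnorm_ge0.
rewrite le_eqVlt => /predU1P[w0|w0].
  exists (fun=> 0); split; first exact: cmeasurable_cst.
    rewrite -w0; apply: (@cintegral_real _ _ (fun=> 0)); last exact: integral0.
    by move=> x; rewrite mulr0.
  by rewrite cLnorm0// lee_fin invr_ge0 ltW.
case: p p1 smu wE => [p|_|//].
  rewrite lee_fin le_eqVlt => /predU1P[<-|p1] smu wE.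
    rewrite hoelder_conjugate1 in wE.
    by apply: extremal_eq1 => //; exact: smu.
  have [g [mg gw g1]] := extremal_gt1 p1 mD mm w0 wE.
  by exists g; split=> //; exact: le_trans g1 r1V.
move=> _ wE; have [g [mg gw g1]] := extremal_eqy mD mm wE.
by exists g; split=> //; exact: le_trans g1 r1V.
Qed.

End extremal.

(** * Weighted norms over a partition *)

Section weighted_norms.
Context d (T : measurableType d) (R : realType).
Context (mu : {measure set T -> \bar R}) (X : nat -> set T) (b : nat -> R).
Context (b0 : forall n, 0 < b n).
Implicit Types (f : T -> R[i]) (u v a : nat -> R[i]).

Let term_ge0 (r : R) u (n : nat) : (0 <= (b n)%:E * (cabs (u n) `^ r)%:E)%E.
Proof. by rewrite mule_ge0// lee_fin ?powR_ge0// ltW. Qed.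

Lemma wseq_norm_ge0 (r : \bar R) u : (0 <= wseq_norm b r u)%E.
Proof.
case: r => [r||] //=; first exact: poweR_ge0.
by apply: le_ereal_sup_tmp; exists (cabs (u 0%N))%:E;
  [exists 0%N => /=|rewrite lee_fin cabs_ge0].
Qed.

Lemma le_wseq_norm (r : \bar R) u v : (1 <= r)%E ->
  (forall n, cabs (u n) <= cabs (v n)) ->
  (wseq_norm b r u <= wseq_norm b r v)%E.
Proof.
case: r => [r||//] /= r1 uv; last first.
  apply/ereal_supP => _ [n /= bn <-]; apply: le_ereal_sup_tmp.
  by exists (cabs (v n))%:E; [exists n|rewrite lee_fin].
have r0 : 0 <= r by rewrite (le_trans ler01).
rewrite gt0_ler_poweR ?invr_ge0 ?in_itv/= ?leey ?andbT//; last 3 first.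
- exact: nneseries_ge0.
- exact: nneseries_ge0.
- apply: lee_nneseries => // n _; apply: lee_wpmul2l.
    by rewrite lee_fin ltW.
  by rewrite lee_fin ge0_ler_powR ?nnegrE ?cabs_ge0.
Qed.

Lemma wseq_normZ_le (r : \bar R) (c : R) u : (1 <= r)%E -> 0 <= c ->
  (wseq_norm b r (fun n => c%:C * u n)%R <= c%:E * wseq_norm b r u)%E.
Proof.
case: r => [r||//] /= r1 c0; last first.
  apply/ereal_supP => _ [n /= bn <-]; rewrite cabsM cabs_real ger0_norm// EFinM.
  apply: lee_wpmul2l; first by rewrite lee_fin.
  by apply: ereal_sup_ubound; exists n.
have r0 : 0 < r by rewrite (lt_le_trans ltr01).
under eq_eseriesr => n _.
  rewrite cabsM cabs_real ger0_norm// powRM ?cabs_ge0// EFinM muleCA; over.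
rewrite nneseriesZl// poweRM ?nneseries_ge0 ?lee_fin ?powR_ge0//.
by rewrite poweR_EFin -powRrM mulfV ?gt_eqF// powRr1.
Qed.

(** For infinite [p] the bounds hold off a null set on each part; countably many
    null sets are discarded. *)
Lemma wfun_norm_le (p : \bar R) f a : (1 <= p)%E -> countable_mpartition X ->
    (forall n, (cLnorm mu p (X n) f <= (cabs (a n))%:E)%E) ->
  (wfun_norm mu X b p f <= wseq_norm b p a)%E.
Proof.
case: p => [p||//] p1 [mX tX XT] fa.
  have p0 : 0 < p by rewrite (lt_le_trans ltr01).
  have fap n : (\int[mu]_(x in X n) (cabs (f x) `^ p)%:E <=
      (cabs (a n) `^ p)%:E)%E.
    rewrite -poweR_cLnorm ?gt_eqF// -poweR_EFin.
    apply: gt0_ler_poweR; first exact: ltW.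
    - by rewrite in_itv /= cLnorm_ge0 leey.
    - by rewrite in_itv /= lee_fin cabs_ge0 leey.
    - exact: fa.
  have f0 n : (0 <= (b n)%:E * \int[mu]_(x in X n) (cabs (f x) `^ p)%:E)%E.
    apply: mule_ge0; first by rewrite lee_fin ltW.
    by apply: integral_ge0 => x _; rewrite lee_fin powR_ge0.
  rewrite /= gt0_ler_poweR ?invr_ge0 ?in_itv/= ?leey ?andbT ?(ltW p0)//;
    last 3 first.
  - exact: nneseries_ge0.
  - by apply: nneseries_ge0 => n _ _; exact: term_ge0.
  - apply: lee_nneseries => // n _; apply: lee_wpmul2l => //.
    by rewrite lee_fin ltW.
rewrite /wfun_norm; have := wseq_norm_ge0 +oo%E a.
case aE : (wseq_norm b +oo a) => [y||]; [|by move=> _; rewrite leey|by []].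
rewrite lee_fin => y0; apply/cLnormy_leP => //.
have ay n : cabs (a n) <= y.
  by rewrite -lee_fin -aE; apply: ereal_sup_ubound; exists n => /=.
have : \forall x \ae mu, forall n, X n x -> cabs (f x) <= y.
  apply/ae_foralln => n; apply/cLnormy_leP => //.
  by apply: le_trans (fa n) _; rewrite lee_fin.
by apply: filterS => x H [n _]; exact: H.
Qed.

(** The sequence [a] consists of the norms of [f] on the parts; since every
    weight [b n] is positive, an infinite one would make the total infinite. *)
Lemma wfun_norm_ge (p : \bar R) f : (1 <= p)%E -> countable_mpartition X ->
    (wfun_norm mu X b p f < +oo)%E ->
  exists2 a : nat -> R, forall n, cLnorm mu p (X n) f = (a n)%:E &
    (wseq_norm b p (fun n => (a n)%:C) <= wfun_norm mu X b p f)%E.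
Proof.
case: p => [p||//] p1 [mX tX XT] foo.
  have p0 : 0 < p by rewrite (lt_le_trans ltr01).
  have int0 n : (0 <= \int[mu]_(x in X n) (cabs (f x) `^ p)%:E)%E.
    by apply: integral_ge0 => x _; rewrite lee_fin powR_ge0.
  have ffin n : cLnorm mu p%:E (X n) f \is a fin_num.
    rewrite ge0_fin_numE ?cLnorm_ge0// ltey; apply/eqP => fy.
    move: foo; rewrite /wfun_norm (@nneseries_pinfty _ _ predT n)//.
    - by rewrite poweRyr ?invr_neq0 ?gt_eqF// ltxx.
    - by move=> k _; rewrite mule_ge0 ?int0// lee_fin ltW.
    - by rewrite -poweR_cLnorm ?gt_eqF// fy poweRyr ?gt_eqF// gt0_muley ?lte_fin.
  exists (fun n => fine (cLnorm mu p%:E (X n) f)) => [n|]; first by rewrite fineK.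
  rewrite /wseq_norm /wfun_norm le_eqVlt; apply/orP; left; apply/eqP.
  congr (_ `^ _)%E.
  apply: eq_eseriesr => n _; congr (_ * _)%E.
  rewrite cabs_real ger0_norm ?fine_ge0 ?cLnorm_ge0//.
  by rewrite -poweR_EFin fineK// poweR_cLnorm// gt_eqF.
rewrite /wfun_norm in foo *; set N := cLnorm _ _ _ _ in foo *.
have NE : N = (fine N)%:E by rewrite fineK// ge0_fin_numE// cLnorm_ge0.
have N0 : 0 <= fine N by rewrite fine_ge0// cLnorm_ge0.
have fN n : (cLnorm mu +oo (X n) f <= N)%E.
  rewrite NE; apply/cLnormy_leP => //.
  have /cLnormy_leP : (N <= (fine N)%:E)%E by rewrite -NE.
  by move=> /(_ N0); apply: filterS => x H Xnx; apply: H; exists n => /=.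
have ffin n : cLnorm mu +oo (X n) f \is a fin_num.
  by rewrite ge0_fin_numE ?cLnorm_ge0//; exact: le_lt_trans (fN n) foo.
exists (fun n => fine (cLnorm mu +oo (X n) f)) => [n|]; first by rewrite fineK.
apply/ereal_supP => _ [n _ <-].
by rewrite cabs_real ger0_norm ?fine_ge0 ?cLnorm_ge0// fineK.
Qed.

End weighted_norms.

(** * Equivalence of the two inequalities *)

Theorem proposition1 (R : realType) (p q : \bar R)
    (hp : (1 <= p)%E) (hpq : (p <= q)%E)
    (d : measure_display) (T : measurableType d)
    (mu : {measure set T -> \bar R})
    (hmu : p = 1%E -> semifinite mu)
    (X : nat -> set T) (hX : countable_mpartition X)
    (b M : nat -> R) (hb : forall n, 0 < b n) (hM : forall n, 0 < M n)
    (m : T -> R[i]) (hm : in_cL mu (hoelder_conjugate p) m)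
    (w : nat -> R)
    (hw : forall n, (w n)%:E = cLnorm mu (hoelder_conjugate p) (X n) m)
    (rho : R) (hrho : 0 < rho) :
  (forall f : T -> R[i], cmeasurable f ->
    (wseq_norm b q (fun n : nat => (((M n)^-1)%:C *
        cintegral mu (initial_part X n) (fun x : T => (m x * f x)%R))%R)
     <= rho%:E * wfun_norm mu X b p f)%E)
  <->
  (forall a : nat -> R[i],
    (wseq_norm b q (fun n : nat =>
        (((M n)^-1)%:C * \sum_(k < n.+1) ((w k)%:C * a k))%R)
     <= rho%:E * wseq_norm b p a)%E).
Proof.
have q1 : (1 <= q)%E := le_trans hp hpq.
have mX n : measurable (X n) by case: hX.
have mm : cmeasurable m := hm.1.
have w0 n : 0 <= w n by rewrite -lee_fin hw cLnorm_ge0.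
have rho0 : (0 <= rho%:E)%E by rewrite lee_fin ltW.
split=> [fun_ineq a|seq_ineq f mf].
  (* The factor [r] on the left absorbs the slack [r^-1] in the norms of the
     extremal functions. *)
  apply/(lee_mul01Pr _ (wseq_norm_ge0 hb _ _)) => r r01.
  have /andP[r0 r1] := r01.
  have /choice[g gP] n : exists g, [/\ cmeasurable g,
      cintegral mu (X n) (fun x => m x * g x) = (w n)%:C &
      (cLnorm mu p (X n) g <= (r^-1)%:E)%E].
    exact: near_extremal.
  have [f mf fE] : exists2 f : T -> R[i], cmeasurable f &
      forall n x, X n x -> f x = (r%:C * a n) * g n x.
    apply: cmeasurable_glue => // n; apply: cmeasurableM.
      exact: cmeasurable_cst.
    by case: (gP n).
  have fle n : (cLnorm mu p (X n) f <= (cabs (a n))%:E)%E.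
    have [mg _ gle] := gP n; rewrite (eq_cLnorm mu p (fE n)).
    have rV0 : 0 <= r^-1 by rewrite invr_ge0 ltW.
    apply: le_trans (cLnormZ_le (r%:C * a n) hp (mX n) mg rV0 gle) _.
    by rewrite cabsM cabs_real gtr0_norm// mulrAC mulfV ?mul1r ?gt_eqF.
  have mgoo n h (c : R) : cmeasurable h -> (cLnorm mu p (X n) h <= c%:E)%E ->
      (\int[mu]_(x in X n) (cabs (m x * h x)%R)%:E < +oo)%E.
    move=> mh hc; have hE : cLnorm mu p (X n) h \is a fin_num.
      by rewrite ge0_fin_numE ?cLnorm_ge0//; exact: le_lt_trans hc (ltry _).
    have := hoelder_cLnorm hp (mX n) mm mh (esym (hw n)) (esym (fineK hE)).
    by move=> /le_lt_trans; apply; exact: ltry.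
  have fint n : cintegral mu (X n) (fun x => m x * f x) =
      r%:C * ((w n)%:C * a n).
    have [mg gint gle] := gP n.
    rewrite (@eq_cintegral _ _ _ _ _ _
      (fun x => (r%:C * a n) * (m x * g n x))); last first.
      by move=> x /fE ->; rewrite mulrCA.
    rewrite cintegralZ ?gint//; first by rewrite -mulrA [a n * _]mulrC.
    - exact: cmeasurableM.
    - exact: mgoo gle.
  apply: le_trans (lee_wpmul2l rho0 (wfun_norm_le hb hp hX fle)).
  apply: le_trans (fun_ineq f mf); rewrite -lee_pdivlMl//.
  apply: le_trans (wseq_normZ_le hb _ q1 _); last by rewrite invr_ge0 ltW.
  apply: le_wseq_norm => // n; rewrite cintegral_initial_part//; last 2 first.
  - exact: cmeasurableM.
  - by move=> k; exact: mgoo (fle k).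
  under [in leRHS]eq_bigr do rewrite fint.
  rewrite -mulr_sumr [in leRHS]mulrCA [(r^-1)%:C]fmorphV mulKf//.
  by rewrite fmorph_eq0 gt_eqF.
have [->|] := eqVneq (wfun_norm mu X b p f) +oo%E.
  by rewrite gt0_muley ?lte_fin// leey.
rewrite -ltey => foo.
have [a aE ale] := wfun_norm_ge hb hp hX foo.
have a0 n : 0 <= a n by rewrite -lee_fin -aE cLnorm_ge0.
apply: le_trans (lee_wpmul2l rho0 ale).
apply: le_trans (seq_ineq _); apply: le_wseq_norm => // n.
rewrite !cabsM ler_wpM2l ?cabs_ge0// cintegral_initial_part//; last 2 first.
- exact: cmeasurableM.
- move=> k; apply: le_lt_trans (ltry (w k * a k)).
  exact: (hoelder_cLnorm hp (mX k) mm mf (esym (hw k)) (aE k)).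
apply: le_trans (cabs_sum _) _.
have -> : \sum_(k < n.+1) (w k)%:C * (a k)%:C =
    (\sum_(k < n.+1) w k * a k)%:C.
  by rewrite rmorph_sum; apply: eq_bigr => k _; rewrite rmorphM.
rewrite cabs_real ger0_norm; last by apply: sumr_ge0 => k _; rewrite mulr_ge0.
apply: ler_sum => k _; exact: (cabs_cintegralM_le hp (mX k) mm mf (esym (hw k)) (aE k)).
Qed.
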